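(* Let $G$ be a compactly covered locally compact topologically quasihamiltonian group, $\phi$ a continuous endomorphism of $G$, and $H$ a closed subgroup of $G$ with $\phi(H)\leq H$. (1) Then $h_{alg}(\phi)\geq h_{alg}(\phi\restriction_H)$. (2) If $H$ is normal and $\bar\phi : G/H\to G/H$ is the induced map, then $h_{alg}(\phi)\geq h_{alg}(\bar\phi)$.
   Context: All topological groups are Hausdorff. A topological group is compactly covered if each of its elements lies in a compact subgroup. A closed subgroup $N$ of a topological group $G$ is topologically quasinormal if $\overline{NL}=\overline{LN}$ for every closed subgroup $L$ of $G$; $G$ is topologically quasihamiltonian if every closed subgroup of $G$ is topologically quasinormal. Algebraic entropy: let $G$ be a locally compact group with right Haar measure $\mu$ and $\phi$ a continuous endomorphism of $G$. For $U\subseteq G$ and $n\geq 1$ put $T_n(\phi,U)=U\cdot\phi(U)\cdots\phi^{n-1}(U)$. For $U$ a compact neighborhood of $e_G$ put $H_{alg}(\phi,U)=\limsup_{n\to\infty}\frac{\log\mu(T_n(\phi,U))}{n}$, and let $h_{alg}(\phi)\in[0,\infty]$ be the supremum of $H_{alg}(\phi,U)$ over all compact neighborhoods $U$ of $e_G$. The entropies of $\phi\restriction_H : H\to H$ and of $\bar\phi : G/H\to G/H$, $\bar\phi(gH)=\phi(g)H$, are computed in the locally compact groups $H$ and $G/H$. *)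

(* Defs.v *)
From HB Require Import structures.
From mathcomp Require Import all_boot all_order all_algebra.
From mathcomp Require Import all_classical all_reals all_analysis.

Set Implicit Arguments.
Unset Strict Implicit.
Unset Printing Implicit Defensive.

Local Open Scope classical_set_scope.
Local Open Scope quotient_scope.
Local Open Scope group_scope.

HB.mixin Record isTopologicalGroup G & Topological G & Group G := {
  mulg_continuous : continuous (fun x : G * G => x.1 * x.2) ;
  invg_continuous : continuous (fun x : G => x^-1)
}.

(* Hausdorff separation is not part of the structure: it is the separate
   hypothesis [hausdorff_space G]. *)
#[short(type="topologicalGroupType")]
HB.structure Definition TopologicalGroup :=
  {G of Topological G & Group G & isTopologicalGroup G}.

Definition mulset (G : groupType) (A B : set G) : set G :=
  [set x * y | x in A & y in B].

Record subgroup (G : groupType) := Subgroup {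
  subgroup_set :> set G ;
  subgroupP : group_closed (mem subgroup_set)
}.

Definition normal_subgroup (G : groupType) (N : subgroup G) : Prop :=
  forall x g : G, subgroup_set N x -> subgroup_set N (x ^ g).

Section TopologicalNotions.
Variable G : topologicalGroupType.

Definition compactly_covered : Prop :=
  forall x : G, exists2 K : subgroup G, compact K & subgroup_set K x.

Definition topologically_quasinormal (N : subgroup G) : Prop :=
  forall L : subgroup G, closed L ->
    closure (mulset N L) = closure (mulset L N).

Definition topologically_quasihamiltonian : Prop :=
  forall N : subgroup G, closed N -> topologically_quasinormal N.

End TopologicalNotions.

Definition subgroup_type (G : groupType) (H : subgroup G) : Type :=
  set_type H.

Section SubgroupGroup.
Variables (G : groupType) (H : subgroup G).

HB.instance Definition _ := SubChoice.on (subgroup_type H).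
HB.instance Definition _ := SubChoice_isSubGroup.Build G (fun x => x \in subgroup_set H)
  (subgroup_type H) (subgroupP H).

End SubgroupGroup.

Section SubgroupTopology.
Variables (G : topologicalGroupType) (H : subgroup G).

HB.instance Definition _ :=
  Topological.copy (subgroup_type H) (set_type H).

Lemma subgroup_val_continuous :
  continuous (val : subgroup_type H -> G).
Proof. exact: (@initial_continuous (set_type H) G set_val). Qed.

Lemma subgroup_cvg (T : topologicalType) (f : T -> subgroup_type H) :
  continuous (val \o f : T -> G) -> continuous f.
Proof.
move=> cf; apply/continuousP => _ [B oB <-].
by move/continuousP: cf => /(_ B oB).
Qed.

Lemma subgroup_mulg_continuous :
  continuous (fun x : subgroup_type H * subgroup_type H => x.1 * x.2).
Proof.
apply: subgroup_cvg => x.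
have -> : val \o (fun x : subgroup_type H * subgroup_type H => x.1 * x.2) =
    (fun x => val x.1 * val x.2) by [].
apply: (@continuous2_cvg _ G G G _ _ (val \o fst) (val \o snd) *%g).
- exact: (@mulg_continuous G (val x.1, val x.2)).
- by apply: continuous_comp; [exact: cvg_fst | exact: subgroup_val_continuous].
- by apply: continuous_comp; [exact: cvg_snd | exact: subgroup_val_continuous].
Qed.

Lemma subgroup_invg_continuous :
  continuous (fun x : subgroup_type H => x^-1).
Proof.
apply: subgroup_cvg => x.
have -> : val \o (fun x : subgroup_type H => x^-1) =
    (fun y : G => y^-1) \o val by [].
by apply: continuous_comp; [exact: subgroup_val_continuous |
                            exact: invg_continuous].
Qed.

HB.instance Definition _ := isTopologicalGroup.Build (subgroup_type H)
  subgroup_mulg_continuous subgroup_invg_continuous.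

End SubgroupTopology.

(* Left cosets: [x] and [y] are identified when [x H = y H]. *)
Section Cosets.
Variables (G : groupType) (H : subgroup G).

Definition lcoset_eq : rel G := fun x y => x^-1 * y \in subgroup_set H.

Lemma lcoset_eqP : equiv_class_of lcoset_eq.
Proof.
have [H1 HV] := subgroupP H.
have HVV := group_closedV (subgroupP H).
have HM := group_closedM (subgroupP H).
split.
- by move=> x; rewrite /lcoset_eq mulVg.
- by move=> x y; apply/idP/idP => /HVV; rewrite invgM invgK.
- move=> y x z; rewrite /lcoset_eq => xy yz.
  by have := HM _ _ xy yz; rewrite mulgA mulgK.
Qed.

Canonical lcoset_equiv := EquivRelPack lcoset_eqP.

End Cosets.

(* G / H; normality of H is an argument because the group law needs it. *)
Definition quotient_type (G : topologicalGroupType) (H : subgroup G)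
    (nH : normal_subgroup H) : Type :=
  quotient_topology {eq_quot lcoset_eq H}.

Section QuotientGroup.
Variables (G : topologicalGroupType) (H : subgroup G).
Variable nH : normal_subgroup H.

Local Notation Q := (quotient_type nH).

HB.instance Definition _ := Topological.copy Q
  (quotient_topology {eq_quot lcoset_eq H}).
HB.instance Definition _ := Quotient.copy Q
  (quotient_topology {eq_quot lcoset_eq H}).

Lemma quotient_eqP (x y : G) :
  \pi_Q x = \pi_Q y <-> x^-1 * y \in subgroup_set H.
Proof.
split; first by move/(eqmodP (lcoset_equiv H) x y).
by move=> h; apply/(eqmodP (lcoset_equiv H) x y).
Qed.

Lemma quotient_normJ (x g : G) :
  x \in subgroup_set H -> x ^ g \in subgroup_set H.
Proof. by rewrite !in_setE; exact: nH. Qed.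

Definition quotient_mul (p q : Q) : Q := \pi_Q (repr p * repr q).
Definition quotient_one : Q := \pi_Q 1.
Definition quotient_inv (p : Q) : Q := \pi_Q (repr p)^-1.

Lemma pi_mulg (x y : G) : \pi_Q (x * y) = quotient_mul (\pi_Q x) (\pi_Q y).
Proof.
have HM := group_closedM (subgroupP H).
have := reprK (\pi_Q x); have := reprK (\pi_Q y).
rewrite /quotient_mul; set y' := repr _; set x' := repr _.
move=> /esym/quotient_eqP hy /esym/quotient_eqP hx; apply/quotient_eqP.
have := HM _ _ (quotient_normJ y hx) hy.
by rewrite /conjg invgM !mulgA !mulgK.
Qed.

Lemma pi_invg (x : G) : \pi_Q x^-1 = quotient_inv (\pi_Q x).
Proof.
have HV := group_closedV (subgroupP H).
have := reprK (\pi_Q x); rewrite /quotient_inv; set x' := repr _.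
move=> /quotient_eqP hx; apply/quotient_eqP.
have := quotient_normJ x'^-1 hx.
by rewrite /conjg !invgK !mulgA mulgV mul1g.
Qed.

Lemma quotient_mulgA : associative quotient_mul.
Proof.
move=> p q r; rewrite -[p]reprK -[q]reprK -[r]reprK.
move: (repr p) (repr q) (repr r) => x y z.
by rewrite -(pi_mulg y z) -(pi_mulg x y) -!pi_mulg mulgA.
Qed.

Lemma quotient_mul1g : left_id quotient_one quotient_mul.
Proof. by move=> p; rewrite -[p]reprK /quotient_one -pi_mulg mul1g. Qed.

Lemma quotient_mulg1 : right_id quotient_one quotient_mul.
Proof. by move=> p; rewrite -[p]reprK /quotient_one -pi_mulg mulg1. Qed.

Lemma quotient_mulVg : left_inverse quotient_one quotient_inv quotient_mul.
Proof. by move=> p; rewrite -[p]reprK -pi_invg -pi_mulg mulVg. Qed.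

Lemma quotient_mulgV : right_inverse quotient_one quotient_inv quotient_mul.
Proof. by move=> p; rewrite -[p]reprK -pi_invg -pi_mulg mulgV. Qed.

HB.instance Definition _ := isGroup.Build Q quotient_mulgA quotient_mul1g
  quotient_mulg1 quotient_mulVg quotient_mulgV.

Lemma quotient_pi_continuous : continuous (\pi_Q : G -> Q).
Proof. exact: (@pi_continuous G {eq_quot lcoset_eq H}). Qed.

Lemma lmul_continuous (g : G) : continuous (fun x : G => g * x).
Proof.
move=> x; apply: (@continuous2_cvg _ G G G _ _ (fun=> g) id *%g).
- exact: (@mulg_continuous G (g, x)).
- exact: cvg_cst.
- exact: cvg_id.
Qed.

Lemma rmul_continuous (g : G) : continuous (fun x : G => x * g).
Proof.
move=> x; apply: (@continuous2_cvg _ G G G _ _ id (fun=> g) *%g).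
- exact: (@mulg_continuous G (x, g)).
- exact: cvg_id.
- exact: cvg_cst.
Qed.

Lemma quotient_pi_open (U : set G) : open U -> open (\pi_Q @` U : set Q).
Proof.
move=> oU; rewrite /open /= /quotient_open.
suff -> : \pi_Q @^-1` (\pi_Q @` U) =
    \bigcup_(h in subgroup_set H) ((fun x : G => x * h) @^-1` U).
  apply: bigcup_open => h _.
  by have /continuousP := @rmul_continuous h; apply.
apply/seteqP; split => x /=.
  move=> [u Uu] /esym/quotient_eqP; rewrite in_setE => Hxu.
  by exists (x^-1 * u) => //=; rewrite mulgA mulgV mul1g.
move=> [h Hh /= Uxh]; exists (x * h) => //; apply/esym/quotient_eqP.
by rewrite in_setE mulgA mulVg mul1g.
Qed.

Lemma quotient_pi_nbhs (x : G) (U : set G) :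
  nbhs x U -> nbhs (\pi_Q x : Q) (\pi_Q @` U).
Proof.
rewrite nbhsE => -[V [oV Vx] VU]; rewrite nbhsE; exists (\pi_Q @` V).
  by split; [exact: quotient_pi_open | exists x].
exact: image_subset.
Qed.

Lemma quotient_mulg_continuous : continuous (fun p : Q * Q => p.1 * p.2).
Proof.
move=> [p q]; rewrite -[p]reprK -[q]reprK.
move: (repr p) (repr q) => {p q} x y U /=.
rewrite -[X in nbhs X U]/(quotient_mul (\pi_Q x) (\pi_Q y)) -pi_mulg.
move=> /(quotient_pi_continuous (x := x * y)).
move=> /(@mulg_continuous G (x, y)) [[A B] /= [xA yB] ABU].
exists (\pi_Q @` A, \pi_Q @` B).
  by split; exact: quotient_pi_nbhs.
move=> [_ _] /= [[a Aa <-] [b Bb <-]].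
have /= := ABU (a, b) (conj Aa Bb).
by rewrite -[X in U X -> _]/(\pi_Q (a * b)) pi_mulg.
Qed.

Lemma quotient_invg_continuous : continuous (fun p : Q => p^-1).
Proof.
move=> p; rewrite -[p]reprK; move: (repr p) => {p} x U /=.
rewrite -[X in nbhs X U]/(quotient_inv (\pi_Q x)) -pi_invg.
move=> /(quotient_pi_continuous (x := x^-1)).
move=> /(@invg_continuous G x) /quotient_pi_nbhs; apply: filterS.
by move=> _ [a /= Ua <-]; move: Ua; rewrite pi_invg.
Qed.

HB.instance Definition _ := isTopologicalGroup.Build Q
  quotient_mulg_continuous quotient_invg_continuous.

End QuotientGroup.

Section InducedMaps.
Variables (G : topologicalGroupType) (H : subgroup G).
Variable phi : {multiplicative G -> G}.
Hypothesis phiH : phi @` H `<=` H.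

Lemma restriction_subproof (x : subgroup_type H) :
  phi (val x) \in subgroup_set H.
Proof. by apply/mem_set/phiH; exists (val x) => //; exact/set_mem/valP. Qed.

Definition endo_restriction (x : subgroup_type H) : subgroup_type H :=
  Sub (phi (val x)) (restriction_subproof x).

Definition endo_quotient (nH : normal_subgroup H) (p : quotient_type nH) :
  quotient_type nH := \pi_(quotient_type nH) (phi (repr p)).

Lemma endo_quotientE (nH : normal_subgroup H) (x : G) :
  endo_quotient (\pi_(quotient_type nH) x) =
  \pi_(quotient_type nH) (phi x).
Proof.
rewrite /endo_quotient; apply/quotient_eqP.
have /quotient_eqP := reprK (\pi_(quotient_type nH) x).
set y := repr _ => Hx.
have -> : (phi y)^-1 * phi x = phi (y^-1 * x).
  by rewrite -{1}(mulVKg y x) gmulfM mulKg.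
by apply/mem_set/phiH; exists (y^-1 * x) => //; exact/set_mem.
Qed.

End InducedMaps.

Arguments endo_quotient {G H} phi nH p.

(* The Borel sigma-algebra of G; the point required by the measurable-space
   structures is the neutral element. *)
Definition pointed_group (G : topologicalGroupType) : Type := G.
HB.instance Definition _ (G : topologicalGroupType) :=
  Choice.on (pointed_group G).
HB.instance Definition _ (G : topologicalGroupType) :=
  isPointed.Build (pointed_group G) (1 : G).

Definition borel (G : topologicalGroupType) :=
  g_sigma_algebraType (@open G : set (set (pointed_group G))).

Section Entropy.
Local Open Scope ring_scope.
Local Open Scope ereal_scope.
Variables (R : realType) (G : topologicalGroupType).
Variable mu : {measure set (borel G) -> \bar R}.

Definition right_haar : Prop :=
  [/\ mu [set: G] != 0,
      forall K : set G, compact K -> mu K < +oo,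
      forall A : set (borel G), measurable A ->
        mu A = ereal_inf [set mu U | U in [set U : set G | open U /\ A `<=` U]],
      forall U : set G, open U ->
        mu U = ereal_sup
          [set mu K | K in [set K : set G | compact K /\ K `<=` U]] &
      forall (A : set (borel G)) (g : G), measurable A ->
        mu (mulset A [set g]) = mu A].

Fixpoint trajectory (phi : G -> G) (U : set G) (n : nat) : set G :=
  if n is m.+1 then mulset (trajectory phi U m) (iter m phi @` U)
  else [set 1%g].

(* The n = 0 term plays no role in the limsup. *)
Definition H_alg (phi : G -> G) (U : set G) : \bar R :=
  limn_esup (fun n => lne (mu (trajectory phi U n)) * (n%:R^-1)%:E).

Definition h_alg (phi : G -> G) : \bar R :=
  ereal_sup [set H_alg phi U | U in [set U | compact U /\ nbhs (1%g : G) U]].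

End Entropy.

(* Main.v *)
From HB Require Import structures.
Require Import Defs.
From mathcomp Require Import all_boot all_order all_algebra.
From mathcomp Require Import all_classical all_reals all_analysis.

(** The trajectories of compact open subgroups determine the entropy, and there
    are enough of these subgroups. In a topologically quasihamiltonian group the
    product [NL] of two compact subgroups is closed, so [NL = LN] and [NL] is
    again a compact subgroup; hence, the group being compactly covered, every
    finite set lies in a compact subgroup ([finite_sub_compact_subgroup]). Local
    compactness upgrades this from finite sets to compact sets, with subgroups
    that are moreover open ([compact_sub_compact_open_subgroup]).

    Let [U] be a compact open subgroup of [G].  Each [T_n(phi, U)] with [n > 0]
    is absorbed by [U] on the left, so it is a finite disjoint union of cosets
    [U t], and their number is [N = mu(T_n(phi, U)) / mu(U)].  A covering by [N]
    right translates of [U] passes to closed subgroups and to quotients: the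
    trace of [U t] on [H] is empty or a translate of the trace of [U], and the
    image of [U t] in [G / H] is a translate of the image of [U].  So a trajectory
    in [H] or in [G / H] that is contained in the trace, or the image, of
    [T_n(phi, U)] has measure at most [N] times the finite measure of the trace,
    or the image, of [U].  Thus it is bounded by [C mu(T_n(phi, U))] with [C]
    independent of [n] ([haar_comparison]), and the constant disappears in
    [limsup log(...) / n] ([limn_esup_lne_scale]).

    It remains to find [U] large enough for a given compact neighborhood [V] of
    the identity in [H] or in [G / H].  In [H] any [U] containing [V] will do; in
    [G / H] one lifts [V] to a compact set of [G] first
    ([quotient_compact_lift]). *)

Set Implicit Arguments.
Unset Strict Implicit.
Unset Printing Implicit Defensive.

Import Order.TTheory GRing.Theory Num.Theory.

Local Open Scope classical_set_scope.

(** * Compact open subgroups *)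

Section SubgroupSets.
Local Open Scope group_scope.
Variable G : groupType.
Implicit Types (K : subgroup G) (A B : set G).

Lemma mulsetS A A' B B' :
  A `<=` A' -> B `<=` B' -> mulset A B `<=` mulset A' B'.
Proof.
by move=> AA BB _ [x /AA Ax [y /BB By <-]]; exists x => //; exists y.
Qed.

Lemma mulset_cons A t (s : seq G) :
  mulset A [set` t :: s] = mulset A [set t] `|` mulset A [set` s].
Proof.
apply/seteqP; split=> [_ [x Ax [y /= + <-]]|_ [[x Ax [_ -> <-]]|[x Ax [y ys <-]]]].
- rewrite inE => /predU1P[->|ys]; first by left; exists x => //; exists t.
  by right; exists x => //; exists y.
- by exists x => //; exists t => //=; exact: mem_head.
- by exists x => //; exists y => //=; rewrite inE ys orbT.
Qed.

Lemma mulset_nil A : mulset A [set` [::] : seq G] = set0.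
Proof. by rewrite -subset0 => x [y _ [z]]. Qed.

Lemma subgroup1 K : subgroup_set K 1.
Proof. by have [/set_mem] := subgroupP K. Qed.

Lemma subgroupV K x : subgroup_set K x -> subgroup_set K x^-1.
Proof. by move=> /mem_set Kx; apply/set_mem/(group_closedV (subgroupP K)). Qed.

Lemma subgroupM K x y : subgroup_set K x -> subgroup_set K y ->
  subgroup_set K (x * y).
Proof.
by move=> /mem_set Kx /mem_set Ky; apply/set_mem/(group_closedM (subgroupP K)).
Qed.

Lemma group_closed_set A : A 1 -> (forall x, A x -> A x^-1) ->
  (forall x y, A x -> A y -> A (x * y)) -> group_closed (mem A).
Proof.
move=> A1 AV AM; split; first exact: mem_set.
by move=> x y /set_mem Ax /set_mem Ay; apply/mem_set/AM/AV.
Qed.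

Lemma mulset_subgroup (L N : subgroup G) :
  mulset N L = mulset L N -> group_closed (mem (mulset N L)).
Proof.
move=> NL; apply: group_closed_set.
- by exists 1; [exact: subgroup1|exists 1; [exact: subgroup1|rewrite mulg1]].
- move=> _ [n Nn [l Ll <-]]; rewrite NL invgM.
  exists l^-1; first exact: subgroupV.
  by exists n^-1 => //; exact: subgroupV.
- move=> _ _ [n Nn [l Ll <-]] [n' Nn' [l' Ll' <-]].
  have : mulset L N (l * n') by exists l => //; exists n'.
  rewrite -NL => -[n2 Nn2 [l2 Ll2 e]].
  exists (n * n2); first exact: subgroupM.
  exists (l2 * l'); first exact: subgroupM.
  by rewrite !mulgA -(mulgA n n2) e !mulgA.
Qed.

End SubgroupSets.

Section TopologicalGroupLemmas.
Local Open Scope group_scope.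
Variable G : topologicalGroupType.

Lemma mulset_compact (A B : set G) :
  compact A -> compact B -> compact (mulset A B).
Proof.
move=> cA cB; have -> : mulset A B = (fun p : G * G => p.1 * p.2) @` (A `*` B).
  apply/seteqP; split=> [_ [x Ax [y By <-]]|_ [[x y] [Ax By] <-]].
    by exists (x, y).
  by exists x => //; exists y.
apply: continuous_compact (compact_setX cA cB).
exact/continuous_subspaceT/mulg_continuous.
Qed.

Lemma rtranslate_open (O : set G) t : open O -> open (mulset O [set t]).
Proof.
move=> oO; have -> : mulset O [set t] = (fun x => x * t^-1) @^-1` O.
  apply/seteqP; split=> [_ [x Ox [_ -> <-]]|x Ox] /=; first by rewrite mulgK.
  by exists (x * t^-1) => //; exists t => //; rewrite mulgVK.
by have /continuousP := @rmul_continuous G t^-1; apply.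
Qed.

Lemma mulset_open (O A : set G) : open O -> open (mulset O A).
Proof.
move=> oO; have -> : mulset O A = \bigcup_(t in A) mulset O [set t].
  apply/seteqP; split=> [_ [x Ox [t At <-]]|_ [t At [x Ox [_ -> <-]]]].
    by exists t => //; exists x => //; exists t.
  by exists x => //; exists t.
by apply: bigcup_open => t _; exact: rtranslate_open.
Qed.

Lemma nbhs1_subgroup_open (K : subgroup G) : nbhs 1 K -> open K.
Proof.
rewrite nbhsE => -[B [oB B1] BK]; suff -> : K = mulset B K :> set G.
  exact: mulset_open.
apply/seteqP; split=> [x Kx|_ [x /BK Kx [y Ky <-]]]; last exact: subgroupM.
by exists 1 => //; exists x => //; rewrite mul1g.
Qed.

Lemma open_subgroup_closed (K : subgroup G) : open K -> closed K.
Proof.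
move=> oK; rewrite -[X in closed X]setCK; apply: open_closedC.
suff -> : ~` (K : set G) = mulset K (~` K) by exact: mulset_open.
apply/seteqP; split=> [x nKx|_ [x Kx [y nKy <-]] Kxy].
  by exists 1; [exact: subgroup1|exists x => //; rewrite mul1g].
by apply: nKy; rewrite -(mulKg x y); apply: subgroupM => //; exact: subgroupV.
Qed.

Lemma compact_finite_translates (K O : set G) : compact K -> open O -> O 1 ->
  exists2 s : seq G, [set` s] `<=` K & K `<=` mulset O [set` s].
Proof.
(* The open-cover form of compactness concerns pointed spaces; [1] is the point. *)
pose pG : ptopologicalType :=
  HB.pack (TopologicalGroup.sort G) (isPointed.Build G 1).
move=> cK oO O1; have : @cover_compact pG K by rewrite -compact_cover.
move=> /(_ G K (fun t => mulset O [set t])) [].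
- by move=> t _; exact: rtranslate_open.
- by move=> x Kx; exists x => //; exists 1 => //; exists x => //; rewrite mul1g.
- move=> D DK KD; exists (finmap.enum_fset D) => x; first by move/DK/set_mem.
  move=> /KD [t Dt [u Ou [_ -> <-]]].
  by exists u => //; exists t.
Qed.

End TopologicalGroupLemmas.

Section CompactOpenSubgroups.
Local Open Scope group_scope.
Variable G : topologicalGroupType.
Hypothesis hausG : hausdorff_space G.
Hypothesis ccG : compactly_covered G.
Hypothesis tqG : topologically_quasihamiltonian G.

(** A product of two compact sets is compact, hence closed, so the closures in
    the definition of quasinormality disappear and the subgroups permute. *)
Lemma compact_subgroup_join (L N : subgroup G) : compact L -> compact N ->
  exists M : subgroup G, [/\ compact M, L `<=` M & N `<=` M].
Proof.
move=> cL cN; have cLN := mulset_compact cL cN.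
have cNL := mulset_compact cN cL.
have clL := compact_closed hausG cL; have clN := compact_closed hausG cN.
have := tqG clL clN.
rewrite -(closure_id _).1; last exact: compact_closed.
rewrite -(closure_id _).1; last exact: compact_closed.
move=> e; exists (Subgroup (mulset_subgroup e)); split=> //= x.
- by exists x => //; exists 1; [exact: subgroup1|rewrite mulg1].
- by exists 1; [exact: subgroup1|exists x => //; rewrite mul1g].
Qed.

Lemma finite_sub_compact_subgroup (s : seq G) :
  exists2 L : subgroup G, compact L & [set` s] `<=` L.
Proof.
elim: s => [|x s [L cL sL]].
  by have [K cK _] := ccG 1; exists K.
have [K cK Kx] := ccG x; have [M [cM KM LM]] := compact_subgroup_join cK cL.
exists M => // y /=; rewrite inE => /predU1P[->|/sL]; [exact: KM|exact: LM].
Qed.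

(** Since [S * S] is compact, it is covered by finitely many translates of [S],
    whence [S * S] is contained in [W = S L] for a compact subgroup [L].  Then
    [S W] is contained in [W], and the stabilizer of [W] under left translation
    is the subgroup sought: it contains [S], so it is open and therefore closed,
    and it is contained in the compact set [W] because [1] is in [W].  The set
    [S] has to be symmetric because the stabilizer asks [g W = W]. *)
Lemma nbhs1_sub_compact_open_subgroup (S : set G) :
  compact S -> nbhs 1 S -> (forall x, S x -> S x^-1) ->
  exists U : subgroup G, [/\ compact U, open U & S `<=` U].
Proof.
move=> cS nS SV; have S1 : S 1 by exact: nbhs_singleton.
have [|s _ SS] := compact_finite_translates (mulset_compact cS cS)
  (@open_interior _ S); first exact: nS.
have [L cL sL] := finite_sub_compact_subgroup s.
pose W := mulset S L.
have SW : mulset S W `<=` W.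
  move=> _ [x Sx [_ [y Sy [l Ll <-]] <-]].
  have [|u /interior_subset Su [t /sL Lt e]] := SS (x * y).
    by exists x => //; exists y.
  exists u => //; exists (t * l); first exact: subgroupM.
  by rewrite !mulgA e.
pose M := [set g | forall w, W w -> W (g * w) /\ W (g^-1 * w)].
have Mgrp : group_closed (mem M).
  apply: group_closed_set.
  - by move=> w Ww; rewrite invg1 mul1g.
  - by move=> x Mx w /Mx[]; rewrite invgK.
  - move=> x y Mx My w Ww; rewrite invgM -!mulgA.
    by split; [apply: (Mx _ _).1; apply: (My _ _).1|
               apply: (My _ _).2; apply: (Mx _ _).2].
have SM : S `<=` M.
  move=> x Sx w Ww; split; apply: SW; first by exists x => //; exists w.
  by exists x^-1; [exact: SV|exists w].
have MW : M `<=` W.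
  move=> x /(_ 1)[|+ _]; last by rewrite mulg1.
  by exists 1 => //; exists 1; [exact: subgroup1|rewrite mulg1].
pose U := Subgroup Mgrp; exists U.
have oU : open U by apply: nbhs1_subgroup_open; exact: filterS nS.
split=> //; apply: subclosed_compact MW; last exact: mulset_compact.
exact: (open_subgroup_closed oU).
Qed.

Hypothesis lcG : locally_compact [set: G].

(** A compact neighborhood of [1] is adjoined to [K], and the union is made
    symmetric, to meet the requirements of the previous lemma. *)
Lemma compact_sub_compact_open_subgroup (K : set G) : compact K ->
  exists U : subgroup G, [/\ compact U, open U & K `<=` U].
Proof.
move=> cK.
have [C nC cC] : exists2 C : set G, nbhs 1 C & compact C.
  have := lcG (I : [set: G] 1); rewrite within_interior; last by rewrite interiorT.
  by case=> C nC [cC _]; exists C.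
pose S0 := C `|` K.
pose S := S0 `|` (fun x => x^-1) @` S0.
have cS0 : compact S0 by exact: compactU.
have [||x|U [cU oU SU]] := @nbhs1_sub_compact_open_subgroup S.
- apply: compactU => //; apply: continuous_compact cS0.
  exact/continuous_subspaceT/invg_continuous.
- by apply: filterS nC => x Cx; left; left.
- case=> [S0x|[y S0y <-]]; first by right; exists x.
  by left; rewrite invgK.
- by exists U; split=> // x Kx; apply: SU; left; right.
Qed.

End CompactOpenSubgroups.

(** * Counting cosets with Haar measure *)

Section BorelSets.
Variable G : topologicalGroupType.

Lemma open_measurable_borel (A : set (borel G)) :
  open (A : set G) -> measurable A.
Proof. exact: sub_sigma_algebra. Qed.

Lemma compact_measurable_borel (A : set (borel G)) : hausdorff_space G ->
  compact (A : set G) -> measurable A.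
Proof.
move=> hG /(compact_closed hG) clA; rewrite -[A]setCK; apply: measurableC.
by apply: open_measurable_borel; exact: closed_openC.
Qed.

End BorelSets.

Section HaarMeasure.
Local Open Scope group_scope.
Local Open Scope ring_scope.
Local Open Scope ereal_scope.
Variables (R : realType) (G : topologicalGroupType).
Variable mu : {measure set (borel G) -> \bar R}.
Hypothesis haar_mu : right_haar mu.

Lemma haar_rtranslate (O : set G) (g : G) : open O ->
  mu (mulset O [set g]) = mu O.
Proof.
by case: haar_mu => _ _ _ _ + oO; apply; exact: open_measurable_borel.
Qed.

Lemma haar_translates_le (O : set G) (s : seq G) : open O ->
  mu (mulset O [set` s]) <= (size s)%:R%:E * mu O.
Proof.
move=> oO; elim: s => [|t s IH]; first by rewrite mulset_nil measure0 mul0e.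
have mt := open_measurable_borel (rtranslate_open t oO).
have ms := open_measurable_borel (mulset_open [set` s] oO).
rewrite mulset_cons.
apply: (@le_trans _ _ (mu (mulset O [set t]) + mu (mulset O [set` s]))).
  exact: measureU2.
rewrite haar_rtranslate//.
by rewrite /= -nat1r EFinD ge0_muleDl// ?lee_fin// mul1e leeD2l.
Qed.

(** Two right cosets of [U] are equal or disjoint, so repeated cosets can be
    dropped from the list [s], after which the measure is additive. *)
Lemma haar_cosets (U : subgroup G) (s : seq G) : open U ->
  exists2 s' : seq G, mulset U [set` s'] = mulset U [set` s] &
    mu (mulset U [set` s]) = (size s')%:R%:E * mu U.
Proof.
move=> oU; elim: s => [|t s [s' es' ms']].
  by exists [::] => //; rewrite mulset_nil measure0 mul0e.
have [Ust|nUst] := pselect (mulset U [set` s] t).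
  suff e : mulset U [set` t :: s] = mulset U [set` s].
    by exists s'; rewrite e.
  rewrite mulset_cons; apply/setUidPr => _ [u Uu [_ -> <-]].
  have [v Uv [y ys <-]] := Ust.
  by exists (u * v)%g; [exact: subgroupM|exists y => //; rewrite mulgA].
exists (t :: s'); first by rewrite !mulset_cons es'.
have mt := open_measurable_borel (rtranslate_open t oU).
have ms := open_measurable_borel (mulset_open [set` s] oU).
transitivity (mu (mulset U [set t]) + mu (mulset U [set` s])); last first.
  rewrite haar_rtranslate//.
  by rewrite ms' /= -nat1r EFinD ge0_muleDl// ?lee_fin// mul1e.
rewrite mulset_cons; apply: measureU => //.
rewrite -subset0 => x [[u Uu [_ -> <-]] [v Uv [y ys e]]].
apply: nUst; exists (u^-1 * v)%g; last first.
  by exists y => //; rewrite -mulgA e mulKg.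
by apply: subgroupM => //; exact: subgroupV.
Qed.

(** The list [s] plays the role of a system of representatives for [U \ T]: its
    size is the index of [U] in [T] when [T] is a subgroup. *)
Lemma compact_coset_count (U : subgroup G) (T : set G) : open U ->
  compact T -> mulset U T `<=` T ->
  exists2 s : seq G, T `<=` mulset U [set` s] & mu T = (size s)%:R%:E * mu U.
Proof.
move=> oU cT UT.
have [s sT Ts] := compact_finite_translates cT oU (subgroup1 U).
have [s' es' ms'] := haar_cosets s oU.
have e : T = mulset U [set` s].
  apply/seteqP; split=> // _ [u Uu [t /sT Tt <-]].
  by apply: UT; exists u => //; exists t.
by exists s'; rewrite ?es' e.
Qed.

(** If [mu O = 0] then every compact set, being covered by finitely many
    translates of [O], is null, and so is [G] by inner regularity. *)
Lemma haar_gt0 (O : set G) : hausdorff_space G -> open O -> O 1%g -> 0 < mu O.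
Proof.
move=> hG oO O1; rewrite lt_neqAle measure_ge0 andbT; apply/eqP => mO0.
have [+ _ _ /(_ _ openT) + _] := haar_mu => /eqP + mGE; apply.
apply/eqP; rewrite eq_le measure_ge0 andbT mGE.
apply: ge_ereal_sup => _ [K [cK _] <-].
have [s _ Ks] := compact_finite_translates cK oO O1.
apply: (@le_trans _ _ (mu (mulset O [set` s]))); last first.
  by rewrite (le_trans (haar_translates_le s oO))// -mO0 mule0.
apply: le_measure => //; rewrite inE; first exact: compact_measurable_borel.
by apply: open_measurable_borel; exact: mulset_open.
Qed.

End HaarMeasure.

Section HaarComparison.
Local Open Scope ring_scope.
Local Open Scope ereal_scope.
Variables (R : realType) (G G' : topologicalGroupType).
Variable mu : {measure set (borel G) -> \bar R}.
Variable nu : {measure set (borel G') -> \bar R}.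
Hypothesis haar_mu : right_haar mu.
Hypothesis haar_nu : right_haar nu.
Hypothesis hausG : hausdorff_space G.

(** Here [T'] stands for a set derived from [T] in another group: every covering
    of [T] by translates of [U] yields a covering of [T'] by at most as many
    translates of [O]. The constant is essentially [nu O / mu U]; it does not
    depend on [T], which is what makes the lemma applicable along a trajectory.
    Taking it at least [1] ensures that its logarithm is nonnegative. *)
Lemma haar_comparison (U : subgroup G) (O : set G') :
  open U -> open O -> nu O < +oo ->
  exists2 C : R, (1 <= C)%R & forall (T : set G) (T' : set G'),
    compact T -> mulset U T `<=` T -> measurable (T' : set (borel G')) ->
    (forall s, T `<=` mulset U [set` s] ->
       exists2 s', (size s' <= size s)%N & T' `<=` mulset O [set` s']) ->
    nu T' <= C%:E * mu T.
Proof.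
move=> oU oO nuO.
have mU0 := haar_gt0 haar_mu hausG oU (subgroup1 U).
have [C C1 CU] : exists2 C : R, (1 <= C)%R & nu O <= C%:E * mu U.
  have nuOE : nu O = (fine (nu O))%:E by rewrite fineK// ge0_fin_numE.
  have [->|muUoo] := eqVneq (mu U) +oo.
    by exists 1%R; rewrite // mul1e leey.
  have muUE : mu U = (fine (mu U))%:E.
    by rewrite fineK// ge0_fin_numE// ltey.
  exists (Num.max 1%R (fine (nu O) / fine (mu U))%R); first by rewrite le_max lexx.
  move: mU0; rewrite nuOE muUE -EFinM lte_fin lee_fin => mU0.
  by rewrite -ler_pdivrMr//= le_max lexx orbT.
exists C => // T T' cT UT mT' cov.
have [s Ts ->] := compact_coset_count haar_mu oU cT UT.
have [s' s's T's'] := cov s Ts.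
apply: (@le_trans _ _ (nu (mulset O [set` s']))).
  apply: le_measure => //; rewrite inE//.
  by apply: open_measurable_borel; exact: mulset_open.
apply: (le_trans (haar_translates_le haar_nu s' oO)).
by rewrite muleCA; apply: lee_pmul; rewrite ?lee_fin ?ler_nat.
Qed.

End HaarComparison.

(** * Trajectories and equivariant homomorphisms *)

Section Trajectories.
Local Open Scope group_scope.
Variable G : topologicalGroupType.

Lemma trajectory_compact (phi : G -> G) (A : set G) n :
  continuous phi -> compact A -> compact (trajectory phi A n).
Proof.
move=> cphi cA; elim: n => [|n IH] /=; first exact: compact_set1.
apply: mulset_compact => //; apply: continuous_compact cA.
apply: continuous_subspaceT; elim: n {IH} => [|n IH] x; first exact: cvg_id.
apply: (@continuous_comp _ _ _ (iter n phi) phi); [exact: IH|exact: cphi].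
Qed.

(** The leftmost factor of [T_(n+1)] is [U] itself, and [U U = U]. *)
Lemma trajectory_absorbs (phi : G -> G) (U : subgroup G) n :
  mulset U (trajectory phi U n.+1) `<=` trajectory phi U n.+1.
Proof.
elim: n => [|n IH] _ [u Uu [x Tx <-]].
  case: Tx => _ -> [_ [v Uv <-] <-]; exists 1 => //.
  by exists (u * v); [exists (u * v) => //; exact: subgroupM|rewrite !mul1g].
case: Tx => y Ty [z Tz <-]; rewrite mulgA.
by exists (u * y); [apply: IH; exists u => //; exists y|exists z].
Qed.

Lemma trajectoryS (phi : G -> G) (A B : set G) n :
  A `<=` B -> trajectory phi A n `<=` trajectory phi B n.
Proof.
by move=> AB; elim: n => //= n IH; apply: mulsetS => //; exact: image_subset.
Qed.

End Trajectories.

Section Equivariance.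
Local Open Scope group_scope.
Variables (G G' : topologicalGroupType) (f : G -> G').
Hypothesis fM : forall x y, f (x * y) = f x * f y.

Let f1 : f 1 = 1.
Proof. by apply: (mulgI (f 1)); rewrite -fM !mulg1. Qed.

Lemma image_mulset (A B : set G) :
  f @` mulset A B = mulset (f @` A) (f @` B).
Proof.
apply/seteqP; split=> [_ [_ [x Ax [y By <-]] <-]|_ [_ [x Ax <-] [_ [y By <-] <-]]].
  by exists (f x); [exists x|exists (f y); [exists y|rewrite fM]].
by exists (x * y); [exists x => //; exists y|rewrite fM].
Qed.

(** If [A t] meets the image of [f], say in [f h], then its preimage is the
    translate by [h] of the preimage of [A]; otherwise it is empty.  As [f] need
    not be surjective, the new list can be shorter. *)
Lemma preimage_translates (A : set G') (s : seq G') :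
  (forall x y, A x -> A y -> A (x * y^-1)) ->
  exists2 s' : seq G, (size s' <= size s)%N &
    f @^-1` mulset A [set` s] `<=` mulset (f @^-1` A) [set` s'].
Proof.
move=> AV; have fV x : f x^-1 = (f x)^-1.
  by apply: (mulgI (f x)); rewrite -fM !mulgV.
elim: s => [|t s [s' ss' cov]]; first by exists [::] => //; rewrite mulset_nil.
have [[h [a Aa [_ -> fh]]]|nh] := pselect (exists h, mulset A [set t] (f h)).
  exists (h :: s') => // x /=; rewrite !mulset_cons => -[[b Ab [_ -> fx]]|/cov].
    left; exists (x * h^-1); last by exists h => //; rewrite mulgVK.
    by rewrite /= fM fV -fx -fh invgM mulgA mulgK; exact: AV.
  by right.
exists s'; first exact: leqW.
move=> x /=; rewrite mulset_cons => -[Atx|/cov//].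
by case: nh; exists x.
Qed.

Variables (phi : G -> G) (psi : G' -> G').
Hypothesis fphi : forall x, f (phi x) = psi (f x).

Lemma image_trajectory (A : set G) n :
  f @` trajectory phi A n = trajectory psi (f @` A) n.
Proof.
have fiter m x : f (iter m phi x) = iter m psi (f x).
  by elim: m => //= m IH; rewrite fphi IH.
elim: n => [|n IH] /=; first by rewrite image_set1 f1.
rewrite image_mulset IH; congr mulset.
apply/seteqP; split=> _ [_ [x Ax <-] <-]; rewrite ?fiter.
  by exists (f x) => //; exists x.
by exists (iter n phi x); [exists x|rewrite fiter].
Qed.

End Equivariance.

(** * Entropy comparison *)

Section LimsupComparison.
Local Open Scope ring_scope.
Local Open Scope ereal_scope.
Variable R : realType.

(** The constant contributes [ln C / n], which tends to [0]; so beyond some rank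
    the first sequence exceeds the second by at most a given [e > 0].  When [a n]
    vanishes its logarithm is [-oo] and there is nothing to compare. *)
Lemma limn_esup_lne_scale (a b : nat -> \bar R) (C : R) : (1 <= C)%R ->
  (forall n, 0 <= b n) -> (forall n, (0 < n)%N -> a n <= C%:E * b n) ->
  limn_esup (fun n => lne (a n) * (n%:R^-1)%:E) <=
  limn_esup (fun n => lne (b n) * (n%:R^-1)%:E).
Proof.
move=> C1 b0 ab; have C0 : (0 < C)%R by exact: lt_le_trans C1.
have key n : (0 < n)%N -> lne (a n) * (n%:R^-1)%:E <=
    lne (b n) * (n%:R^-1)%:E + (ln C / n%:R)%:E.
  move=> n0; have n0' : (0 < n%:R^-1 :> R)%R by rewrite invr_gt0 ltr0n.
  have [an0|an0] := leP (a n) 0.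
    by rewrite (le0_lneNy an0) gt0_mulNye ?leNye// lte_fin.
  have bn0 : 0 < b n.
    rewrite lt_neqAle b0 andbT; apply/eqP => bn0.
    by have := lt_le_trans an0 (ab _ n0); rewrite -bn0 mule0 ltxx.
  have -> : (ln C / n%:R)%:E = lne C%:E * (n%:R^-1)%:E by rewrite lne_EFin.
  rewrite -muleDl//; last first.
    by rewrite lne_EFin// /adde_def; case: (lne (b n)).
  rewrite lee_pmul2r// ?lte_fin//.
  rewrite addeC -lneM ?in_itv/= ?lte_fin ?leey ?C0 ?bn0//.
  rewrite lee_lne ?ab// in_itv/= leey andbT; first exact: ltW.
  by rewrite mule_ge0// lee_fin ltW.
rewrite {2}/limn_esup limf_esupE; apply: le_ereal_inf_tmp => _ [V ooV <-].
apply/lee_addgt0Pr => e e0; rewrite /limn_esup limf_esupE.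
pose W := V `&` [set n | (0 < n)%N /\ (ln C / n%:R <= e)%R].
apply: (@le_trans _ _ (ereal_sup
    ((fun n => lne (a n) * (n%:R^-1)%:E) @` W))); last first.
  apply: ge_ereal_sup => _ [n [Vn [n0 ne]] <-].
  apply: (le_trans (key n n0)); apply: leeD; last by rewrite lee_fin.
  by apply: ereal_sup_ubound; exists n.
apply: ereal_inf_lbound; exists W => //; apply: filterI => //.
near=> n; have n0 : (0 < n)%N by near: n; exists 1%N.
split=> //; rewrite ler_pdivrMr ?ltr0n// mulrC -ler_pdivrMr//.
by near: n; exact: nbhs_infty_ger.
Unshelve. all: by end_near. Qed.

End LimsupComparison.

Section EntropyComparison.
Local Open Scope ring_scope.
Local Open Scope ereal_scope.
Variables (R : realType) (G G' : topologicalGroupType).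
Variable mu : {measure set (borel G) -> \bar R}.
Variable nu : {measure set (borel G') -> \bar R}.
Hypothesis haar_mu : right_haar mu.
Hypothesis haar_nu : right_haar nu.
Hypotheses (hausG : hausdorff_space G) (hausG' : hausdorff_space G').
Variables (phi : G -> G) (psi : G' -> G').
Hypotheses (cphi : continuous phi) (cpsi : continuous psi).

(** The common form of both parts of the theorem.  The sets [V] and [O] live in
    the subgroup or in the quotient, and [O] is the trace or the image of [U]. *)
Lemma H_alg_le_h_alg (U : subgroup G) (O V : set G') :
  compact U -> open U -> compact V -> open O -> nu O < +oo ->
  (forall n s, trajectory phi U n `<=` mulset U [set` s] ->
    exists2 s', (size s' <= size s)%N &
      trajectory psi V n `<=` mulset O [set` s']) ->
  H_alg nu psi V <= h_alg mu phi.
Proof.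
move=> cU oU cV oO nuO cov.
apply: (@le_trans _ _ (H_alg mu phi U)); last first.
  apply: ereal_sup_ubound; exists U => //; split=> //.
  by apply: open_nbhs_nbhs; split=> //; exact: subgroup1.
have [C C1 nuC] := haar_comparison haar_mu haar_nu hausG oU oO nuO.
apply: (@limn_esup_lne_scale _ _ _ C) => // -[//|n] _.
apply: nuC; first exact: trajectory_compact.
- exact: trajectory_absorbs.
- by apply: compact_measurable_borel => //; exact: trajectory_compact.
- exact: cov.
Qed.

End EntropyComparison.

(** * Closed subgroups and quotients *)

Section SubgroupTopologyFacts.
Local Open Scope group_scope.
Variables (G : topologicalGroupType) (H : subgroup G).
Local Notation HT := (subgroup_type H).

Lemma subgroup_hausdorff : hausdorff_space G -> hausdorff_space HT.
Proof.
move=> hG p q pq; apply/val_inj/hG => A B pA qB.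
have [x [Ax Bx]] := pq _ _ (@subgroup_val_continuous G H p A pA)
  (@subgroup_val_continuous G H q B qB).
by exists (val x).
Qed.

(** A filter on [H] containing the trace of [K] clusters in [G] at a point of
    [K]; this point is in [H] because [H] is closed, and it is a cluster point in
    [H] because [H] carries the initial topology. *)
Lemma subgroup_preimage_compact (K : set G) : closed H -> compact K ->
  compact ((val : HT -> G) @^-1` K).
Proof.
move=> clH cK F FF FK.
have [x [[Kx Hx] xF]] : K `&` H `&` cluster ((val : HT -> G) @ F) !=set0.
  apply: (compact_closedI cK clH).
  suff : F ((val : HT -> G) @^-1` (K `&` H)) by [].
  by apply: filterS FK => y Ky; split=> //; exact: (set_mem (valP y)).
pose y : HT := Sub x (mem_set Hx).
have yx : val y = x by rewrite SubK.
exists y; split; first exact: (eq_ind_r K Kx yx).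
move=> A B FA; rewrite nbhsE => -[C [oC Cy] CB].
have [D oD DC] := oC.
have [_ [[z Az <-] Dz]] : (val : HT -> G) @` A `&` D !=set0.
  apply: xF; last apply: open_nbhs_nbhs.
    suff : F ((val : HT -> G) @^-1` (val @` A)) by [].
    by apply: filterS FA => z Az; exists z.
  by split=> //; move: Cy; rewrite -DC => Dy; exact: (eq_ind _ D Dy _ yx).
by exists z; split=> //; apply: CB; rewrite -DC.
Qed.

Lemma endo_restriction_continuous (phi : {multiplicative G -> G})
    (phiH : phi @` H `<=` H) :
  continuous phi -> continuous (endo_restriction phiH).
Proof.
move=> cphi; apply: subgroup_cvg => x.
have -> : val \o endo_restriction phiH = phi \o val.
  by apply/funext => y.
by apply: continuous_comp; [exact: subgroup_val_continuous|exact: cphi].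
Qed.

End SubgroupTopologyFacts.

Section QuotientTopologyFacts.
Local Open Scope quotient_scope.
Local Open Scope group_scope.
Variables (G : topologicalGroupType) (H : subgroup G) (nH : normal_subgroup H).
Local Notation Q := (quotient_type nH).

(** If [x H] and [y H] differ then [x^-1 * y] lies in the open complement of [H];
    by continuity so does [a^-1 * b] for [a] near [x] and [b] near [y], and the
    images of these two neighborhoods are disjoint neighborhoods. *)
Lemma quotient_hausdorff : closed H -> hausdorff_space Q.
Proof.
move=> clH p q; rewrite -[p]reprK -[q]reprK.
move: (repr p) (repr q) => {p q} x y pq; apply/quotient_eqP/mem_set.
apply: contrapT => nHxy.
have : nbhs (x^-1 * y) (~` (H : set G)).
  by apply: open_nbhs_nbhs; split=> //; exact: closed_openC.
move=> /(@mulg_continuous G (x^-1, y)) [[A B] /= [xA yB] AB].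
have xA' : nbhs (x : G) [set z : G | A z^-1] by exact: (@invg_continuous G x).
have [_ [[a Aa <-] [b Bb]]] := pq _ _ (quotient_pi_nbhs nH xA')
  (quotient_pi_nbhs nH yB).
move=> /esym/quotient_eqP/set_mem; exact: (AB (a^-1, b) (conj Aa Bb)).
Qed.

(** Finitely many translates of [U] form a relatively compact subset of [G] when
    [U] is relatively compact, so this lifts compact subsets of [G / H] to
    compact subsets of [G]. *)
Lemma quotient_compact_lift (K : set Q) (U : set G) :
  compact K -> open U -> U 1 ->
  exists s : seq G, K `<=` mulset (\pi_Q @` U) [set` map \pi_Q s].
Proof.
move=> cK oU U1.
have [||s _ Ks] := @compact_finite_translates Q K (\pi_Q @` U) cK.
- exact: quotient_pi_open.
- by exists 1.
- exists (map repr s); rewrite -map_comp map_id_in// => p _ /=; exact: reprK.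
Qed.

Lemma endo_quotient_continuous (phi : {multiplicative G -> G}) :
  phi @` H `<=` H ->
  continuous phi -> continuous (endo_quotient phi nH).
Proof.
move=> phiH cphi; apply/(@quotient_continuous G {eq_quot lcoset_eq H}).
have -> : endo_quotient phi nH \o \pi_Q = \pi_Q \o phi.
  by apply/funext => x /=; rewrite endo_quotientE.
move=> x; apply: continuous_comp; first exact: cphi.
exact: quotient_pi_continuous.
Qed.

End QuotientTopologyFacts.

Local Open Scope ring_scope.
Local Open Scope ereal_scope.

Theorem proposition4p4 (R : realType) (G : topologicalGroupType)
    (hausG : hausdorff_space G) (lcG : locally_compact [set: G])
    (ccG : compactly_covered G) (tqG : topologically_quasihamiltonian G)
    (phi : {multiplicative G -> G}) (cphi : continuous phi)
    (H : subgroup G) (clH : closed H) (phiH : phi @` H `<=` H)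
    (mu : {measure set (borel G) -> \bar R}) (haar_mu : right_haar mu) :
  (forall nu : {measure set (borel (subgroup_type H)) -> \bar R},
     right_haar nu -> h_alg nu (endo_restriction phiH) <= h_alg mu phi) /\
  (forall (nH : normal_subgroup H)
     (nu : {measure set (borel (quotient_type nH)) -> \bar R}),
     right_haar nu -> h_alg nu (endo_quotient phi nH) <= h_alg mu phi).
Proof.
have compact_open := compact_sub_compact_open_subgroup hausG ccG tqG lcG.
split=> [nu haar_nu|nH nu haar_nu]; apply: ge_ereal_sup => _ [V [cV _] <-].
- pose i : subgroup_type H -> G := val.
  have ci : continuous i := @subgroup_val_continuous G H.
  have iM x y : i (x * y)%g = (i x * i y)%g by [].
  have [|U [cU oU VU]] := compact_open (i @` V).
    by apply: continuous_compact cV; exact: continuous_subspaceT.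
  have [_ nu_fin _ _ _] := haar_nu.
  have cr : continuous (endo_restriction phiH) by exact: endo_restriction_continuous.
  have hH := @subgroup_hausdorff G H hausG.
  apply: (H_alg_le_h_alg haar_mu haar_nu hausG hH cphi cr cU oU cV
    (O := i @^-1` U)).
  + by move/continuousP: ci; apply.
  + by apply: nu_fin; exact: subgroup_preimage_compact.
  + move=> n s Ts.
    have [|s' s's cov] := preimage_translates (A := U) iM s.
      by move=> x y Ux Uy; apply: subgroupM => //; exact: subgroupV.
    exists s' => // x Tx; apply: cov; apply: Ts.
    apply: (trajectoryS VU).
    by rewrite -(image_trajectory iM (phi := endo_restriction phiH)).
- pose p : G -> quotient_type nH := \pi_(quotient_type nH)%qT.
  have cp : continuous p := @quotient_pi_continuous G H nH.
  have pM x y : p (x * y)%g = (p x * p y)%g by exact: pi_mulg.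
  (* [U] must contain [U0 t] for the finitely many [t] of a lift of [V]. *)
  have [U0 [cU0 oU0 _]] := compact_open set0 compact0.
  have [s Vs] := quotient_compact_lift cV oU0 (subgroup1 U0).
  have [|U [cU oU sU]] := compact_open (mulset U0 [set` s]).
    by apply: mulset_compact => //; apply: finite_compact; exact: finite_seq.
  have VU : V `<=` p @` U.
    move=> _ /Vs [_ [u Uu <-] [_ /mapP[t ts ->] <-]].
    by exists (u * t)%g; [apply: sU; exists u => //; exists t|rewrite pM].
  have [_ nu_fin _ _ _] := haar_nu.
  have cq : continuous (endo_quotient phi nH) by exact: endo_quotient_continuous.
  have hQ : hausdorff_space (quotient_type nH) by exact: quotient_hausdorff.
  apply: (H_alg_le_h_alg haar_mu haar_nu hausG hQ cphi cq cU oU cV (O := p @` U)).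
  + exact: quotient_pi_open.
  + by apply: nu_fin; apply: continuous_compact cU; exact: continuous_subspaceT.
  + move=> n s' Ts; exists (map p s'); first by rewrite size_map.
    apply: (subset_trans (trajectoryS VU)).
    rewrite -(image_trajectory pM (phi := phi))//; last first.
      by move=> x; rewrite /p endo_quotientE.
    move=> _ [x /Ts [u Uu [t ts <-]] <-]; rewrite pM.
    exists (p u); first by exists u.
    by exists (p t) => //; exact: map_f.
Qed.
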